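(* Let $G$ be a graph of order $n$ with minimum degree $\delta$ and maximum degree $\Delta$. If $k\ge 3$ is an integer and $\delta \ge k-1$, then $$\psi_k(G) \ge \frac{\delta-k+2}{\delta+\Delta-k+2}\; n.$$
   Context: Graphs are finite, simple and undirected. The order of $G$ is $n=|V(G)|$. $P_k$ denotes the path with $k$ vertices. A $k$-path vertex cover of $G$ is a set $T\subseteq V(G)$ such that $G-T$ contains no (not necessarily induced) subgraph isomorphic to $P_k$. $\psi_k(G)$ is the minimum cardinality of a $k$-path vertex cover of $G$. *)

(* Defs.v *)
From mathcomp Require Import all_boot all_order all_algebra.

Set Implicit Arguments.
Unset Strict Implicit.
Unset Printing Implicit Defensive.

Record sgraph := SGraph {
  vertex :> finType;
  adj : rel vertex;
  adj_sym : symmetric adj;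
  adj_irrefl : irreflexive adj
}.

Definition degree (G : sgraph) (v : G) : nat := #|[set w | adj v w]|.

(* Every degree is less than #|G|, so for G nonempty the default value #|G| is
   never attained and this is the true minimum; for G empty it is 0. *)
Definition min_degree (G : sgraph) : nat := \big[minn/#|G|]_(v : G) degree v.

Definition max_degree (G : sgraph) : nat := \max_(v : G) degree v.

Section PathGraph.
Variable k : nat.

Definition path_adj : rel 'I_k := fun i j => (i.+1 == j) || (j.+1 == i).

Fact path_adj_sym : symmetric path_adj.
Proof. by move=> i j; rewrite /path_adj orbC. Qed.

Fact path_adj_irrefl : irreflexive path_adj.
Proof. by move=> i; rewrite /path_adj orbb eqn_leq ltnn. Qed.

(* k counts vertices, not edges. *)
Definition path_graph : sgraph := SGraph path_adj_sym path_adj_irrefl.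

End PathGraph.

Section DeleteVertices.
Variables (G : sgraph) (S : {set G}).

Definition del_adj : rel {x : G | x \notin S} := fun x y => adj (val x) (val y).

Fact del_adj_sym : symmetric del_adj.
Proof. by move=> x y; rewrite /del_adj adj_sym. Qed.

Fact del_adj_irrefl : irreflexive del_adj.
Proof. by move=> x; rewrite /del_adj adj_irrefl. Qed.

Definition del_vertices : sgraph := SGraph del_adj_sym del_adj_irrefl.

End DeleteVertices.

(* G has a subgraph isomorphic to H: the subgraph consists of the images under f
   of the vertices and edges of H.  Since adj (f x) (f y) need not imply adj x y,
   the subgraph need not be induced. *)
Definition has_subgraph (G H : sgraph) : bool :=
  [exists f : {ffun H -> G},
    injectiveb f && [forall x, forall y, adj x y ==> adj (f x) (f y)]].

Definition kpath_vertex_cover (k : nat) (G : sgraph) (S : {set G}) : bool :=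
  ~~ has_subgraph (del_vertices S) (path_graph k).

(* For k > 0 the whole vertex set is a k-path vertex cover, of cardinality #|G|,
   so the default value does not affect the minimum. *)
Definition psi (k : nat) (G : sgraph) : nat :=
  \big[minn/#|G|]_(S : {set G} | kpath_vertex_cover k S) #|S|.

(* Main.v *)
Require Import Defs.
From mathcomp Require Import all_boot all_order all_algebra.
From mathcomp Require Import zify ring.

(** Let [S] be a [k]-path vertex cover and [F] its complement, so that [F]
    spans no path on [k] vertices.  The theorem is a double count of the edges
    between [F] and [S].  Each vertex of [S] sends at most [Delta] of them.  On
    the other side the degrees in [G] over [F] add up to at least
    [delta * #|F|], and by the Erdos-Gallai theorem ([erdos_gallai]) the
    degrees inside [F] add up to at most [(k - 2) * #|F|]; hence
    [(delta - k + 2) * #|F| <= Delta * #|S|], which rearranges to the claim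
    because [#|F| = n - #|S|].

    The Erdos-Gallai theorem is proved by repeatedly removing from [F] a
    nonempty piece that meets few edges ([sparse_piece]).  Take a longest path
    in [F]; all neighbours of its two ends lie on it.  If the degrees of the
    ends add up to at most the length of the path, then one end has degree at
    most [(k - 2) / 2], and that end is the piece.  Otherwise the
    pigeonhole argument of Ore and Posa ([consecutive_pair],
    [cycle_of_crossing]) closes the path up into a cycle on the same vertices.
    An edge leaving that cycle would give a longer path, so the vertex set of
    the cycle is a union of components of [F], with at most [k - 1] vertices,
    and this is the piece. *)

Import Order.TTheory GRing.Theory Num.Theory.

(** * Counting edges between vertex sets *)

Section Edges.
Variable G : sgraph.
Implicit Types (A B F S : {set G}) (v w : G).

(** The ordered count: an edge with both ends in [A :&: B] contributes twice,
    so that [edges F F] is the degree sum of the graph induced on [F]. *)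
Definition edges A B : nat := \sum_(a in A) \sum_(b in B) adj a b.

Lemma edgesC A B : edges A B = edges B A.
Proof.
rewrite /edges exchange_big /=; apply: eq_bigr => b _.
by apply: eq_bigr => a _; rewrite adj_sym.
Qed.

Lemma edges_splitl S F B : S \subset F ->
  edges F B = edges S B + edges (F :\: S) B.
Proof. by move=> sSF; rewrite /edges (big_setID S) /= (setIidPr sSF). Qed.

Lemma edges_splitr S F A : S \subset F ->
  edges A F = edges A S + edges A (F :\: S).
Proof. by move=> sSF; rewrite edgesC (edges_splitl _ _ _ sSF) !(edgesC A). Qed.

Lemma edges_set1l v B : edges [set v] B = \sum_(b in B) adj v b.
Proof. by rewrite /edges big_set1. Qed.

Lemma edges_set11 v : edges [set v] [set v] = 0.
Proof. by rewrite edges_set1l big_set1 adj_irrefl. Qed.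

Lemma sum_adjE v B : \sum_(b in B) adj v b = #|[set b in B | adj v b]|.
Proof.
rewrite -sum1_card big_mkcond [RHS]big_mkcond /=; apply: eq_bigr => b _.
by rewrite inE; case: (b \in B); case: (adj v b).
Qed.

Lemma sum_adj_le_degree v B : \sum_(b in B) adj v b <= degree v.
Proof.
by rewrite sum_adjE; apply/subset_leq_card/subsetP => b; rewrite !inE => /andP[].
Qed.

Lemma edges_le_max_degree A B : edges A B <= max_degree G * #|A|.
Proof.
rewrite mulnC -sum_nat_const; apply: leq_sum => a _.
exact: leq_trans (sum_adj_le_degree a B) (leq_bigmax a).
Qed.

Lemma min_degree_le v : min_degree G <= degree v.
Proof.
rewrite /min_degree; have := mem_index_enum v.
elim: (index_enum _) => // u s IHs; rewrite inE big_cons => /orP[/eqP-> | vs].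
  exact: geq_minl.
exact: leq_trans (geq_minr _ _) (IHs vs).
Qed.

Lemma min_degree_le_edges A : min_degree G * #|A| <= edges A [set: G].
Proof.
rewrite mulnC -sum_nat_const; apply: leq_sum => a _.
rewrite sum_adjE; apply: leq_trans (min_degree_le a) _.
by apply/subset_leq_card/subsetP => b; rewrite !inE.
Qed.

Lemma edges_self_le S : edges S S <= #|S|.-1 * #|S|.
Proof.
rewrite mulnC -sum_nat_const; apply: leq_sum => a aS.
rewrite sum_adjE (cardsD1 a S) aS /=.
apply/subset_leq_card/subsetP => b; rewrite !inE => /andP[-> ab].
by rewrite andbT; apply: contraTneq ab => ->; rewrite adj_irrefl.
Qed.

(** * Longest paths *)

Definition spath F (s : seq G) : bool :=
  [&& sorted (@adj G) s, uniq s & all (mem F) s].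

Lemma spath_rev F s : spath F (rev s) = spath F s.
Proof.
rewrite /spath rev_sorted rev_uniq all_rev; congr (_ && _).
by apply: eq_sorted => a b; rewrite adj_sym.
Qed.

Lemma spath_cons F z x p :
  spath F (x :: p) -> z \in F -> adj x z -> z \notin x :: p ->
  spath F (z :: x :: p).
Proof.
move=> /and3P[srt unq sub] zF xz zNp; apply/and3P; split.
- by rewrite /= adj_sym xz.
- by rewrite cons_uniq zNp.
- by apply/andP; split.
Qed.

Definition longest_spath F (s : seq G) := forall t, spath F t -> size t <= size s.

Lemma longest_spath_ex F v : v \in F ->
  exists x p, spath F (x :: p) /\ longest_spath F (x :: p).
Proof.
move=> vF; pose P m := [exists s : m.-tuple G, spath F s].
have P1 : P 1 by apply/existsP; exists [tuple v]; rewrite /spath /= vF.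
have Pub m : P m -> m <= #|G|.
  case/existsP=> s /and3P[_ unq _].
  by rewrite -(size_tuple s) -(card_uniqP unq) max_card.
have exP : exists m, P m by exists 1.
case: (ex_maxnP exP Pub) => m /existsP[s sP] smax.
have longest : longest_spath F s.
  move=> t tP; rewrite size_tuple; apply: smax.
  by apply/existsP; exists (in_tuple t).
have := smax _ P1; rewrite -(size_tuple s).
case: (tval s) sP longest => // x p xpP longest _.
by exists x, p.
Qed.

Lemma longest_spath_head F x p z :
  spath F (x :: p) -> longest_spath F (x :: p) ->
  z \in F -> adj x z -> z \in x :: p.
Proof.
move=> sP longest zF xz; apply/negPn/negP => zNp.
by have := longest _ (spath_cons _ _ _ _ sP zF xz zNp); rewrite ltnn.
Qed.

(** The reverse of a longest path is one too, and it starts at the other end. *)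
Lemma longest_spath_last F x p z :
  spath F (x :: p) -> longest_spath F (x :: p) ->
  z \in F -> adj (last x p) z -> z \in x :: p.
Proof.
rewrite /longest_spath -spath_rev -size_rev -mem_rev lastI rev_rcons.
exact: longest_spath_head.
Qed.

(** Up to rotation, an edge leaving the cycle attaches to its first vertex;
    cutting the cycle open there and prepending the new vertex gives a path. *)
Lemma spath_of_cycle F c w z :
  cycle (@adj G) c -> uniq c -> all (mem F) c ->
  w \in c -> z \in F -> adj w z -> z \notin c ->
  exists2 t, spath F t & size t = (size c).+1.
Proof.
move=> cyc unq sub wc zF wz zNc; have [i c' rotE] := rot_to wc.
have sz_rot : size c = (size c').+1 by rewrite -(size_rot i) rotE.
exists (z :: w :: c'); last by rewrite sz_rot.
apply: spath_cons => //; last by rewrite -rotE mem_rot.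
apply/and3P; split.
- by move: cyc; rewrite -(rot_cycle i) rotE /= rcons_path => /andP[].
- by rewrite -rotE rot_uniq.
- by apply/allP => u; rewrite -rotE mem_rot => /(allP sub).
Qed.

(** * Closing a path into a cycle *)

(** Pigeonhole: if no two consecutive entries [a], [b] satisfy [Q a] and
    [P b], then each of the [size p] consecutive pairs contributes at most
    once to the two counts. *)
Lemma consecutive_pair (T : Type) (P Q : pred T) x p :
  size p < count P p + count Q (belast x p) ->
  exists p1 a b p2, [/\ x :: p = p1 ++ a :: b :: p2, P b & Q a].
Proof.
elim: p x => // y p IHp x /= lt_sz.
case: (boolP (Q x && P y)) => [/andP[Qx Py] | NQP].
  by exists [::], x, y, p.
have /IHp[p1 [a [b [p2 [-> Pb Qa]]]]] : size p < count P p + count Q (belast y p).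
  by move: NQP lt_sz; case: (Q x); case: (P y) => //= _; lia.
by exists (x :: p1), a, b, p2.
Qed.

(** With chords from [x] to [b] and from the last vertex to [a], one walks
    from [x] to [a], jumps to the last vertex, walks back to [b] and
    returns to [x]. *)
Lemma cycle_of_crossing x p p1 a b p2 :
  sorted (@adj G) (x :: p) -> x :: p = p1 ++ a :: b :: p2 ->
  adj x b -> adj (last x p) a ->
  cycle (@adj G) (rcons p1 a ++ rev (b :: p2)).
Proof.
move=> srt defp xb ya.
have lastE : last x p = last b p2.
  by have := congr1 (last x) defp; rewrite /= last_cat.
have /andP[srt1 srt2] : sorted (@adj G) (rcons p1 a) && path (@adj G) b p2.
  move: srt; rewrite defp -cat_rcons.
  case: p1 {defp} => [|u p1] /=; first by case/andP.
  by rewrite cat_path last_rcons /= => /and3P[-> _ ->].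
have {}srt2 : path (@adj G) (last b p2) (rev (belast b p2)).
  by rewrite rev_path; apply: sub_path srt2 => u v; rewrite adj_sym.
have revE : rev (b :: p2) = last b p2 :: rev (belast b p2).
  by rewrite lastI rev_rcons.
have last_rev : last (last b p2) (rev (belast b p2)) = b.
  by have := congr1 (last b) revE; rewrite rev_cons last_rcons.
have headE : exists q, rcons p1 a = x :: q.
  by case: p1 defp {srt1} => [|u p1] [-> _]; eexists.
case: headE srt1 => q defq; rewrite defq revE /= => srt1.
rewrite rcons_cat cat_path srt1 /= rcons_path srt2 last_rev.
have -> : last x q = a by rewrite -[RHS](last_rcons x p1) defq.
by rewrite adj_sym -lastE ya adj_sym xb.
Qed.

(** * The Erdos-Gallai theorem *)

Lemma sum_adj_le_count F v s :
  {in F, forall z, adj v z -> z \in s} ->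
  \sum_(b in F) adj v b <= count (@adj G v) s.
Proof.
move=> Ns; rewrite sum_adjE -size_filter.
apply: leq_trans (card_size _); apply/subset_leq_card/subsetP => z.
by rewrite inE mem_filter => /andP[zF vz]; rewrite vz Ns.
Qed.

(** Removing [S] from [F] lowers [edges F F] by exactly the left-hand side, and
    [#|F|] by [#|S|]; the bound is thus what an induction on [F] requires. *)
Lemma sparse_piece F d v :
  v \in F -> (forall s, spath F s -> size s <= d.+1) ->
  exists S, [/\ S \subset F, 0 < #|S| &
    edges S S + (edges S (F :\: S)).*2 <= d * #|S|].
Proof.
move=> vF bound; have [x [p [sP longest]]] := longest_spath_ex _ _ vF.
have size_p : size p <= d by have := bound _ sP.
have /and3P[srt unq /allP sub] := sP.
have low_degree u : u \in F -> (\sum_(b in F) adj u b).*2 <= d ->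
    exists S, [/\ S \subset F, 0 < #|S| &
      edges S S + (edges S (F :\: S)).*2 <= d * #|S|].
  move=> uF deg_u; exists [set u]; rewrite sub1set uF cards1; split=> //.
  rewrite edges_set11 muln1; apply: leq_trans deg_u.
  have uF' : [set u] \subset F by rewrite sub1set.
  by rewrite add0n leq_double -edges_set1l (edges_splitr _ _ _ uF') leq_addl.
have deg_x : \sum_(b in F) adj x b <= count (adj x) p.
  have -> : count (adj x) p = count (adj x) (x :: p) by rewrite /= adj_irrefl.
  by apply: sum_adj_le_count => z; apply: longest_spath_head.
have deg_y : \sum_(b in F) adj (last x p) b
             <= count (adj (last x p)) (belast x p).
  have -> : count (adj (last x p)) (belast x p)
            = count (adj (last x p)) (x :: p).
    by rewrite lastI -cats1 count_cat /= adj_irrefl !addn0.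
  by apply: sum_adj_le_count => z; apply: longest_spath_last.
case: (leqP (count (adj x) p + count (adj (last x p)) (belast x p)) (size p)).
  move=> small.
  have [le_xy | lt_yx] := leqP (\sum_(b in F) adj x b)
                               (\sum_(b in F) adj (last x p) b).
    by apply: (low_degree x); [apply/sub/mem_head | lia].
  by apply: (low_degree (last x p)); [apply/sub/mem_last | lia].
case/(consecutive_pair _ _ _ _ _)=> p1 [a [b [p2 [defp xb ya]]]].
have := cycle_of_crossing _ _ _ _ _ _ srt defp xb ya.
set c := rcons p1 a ++ _ => cyc.
have perm_c : perm_eq c (x :: p) by rewrite defp -cat_rcons perm_cat2l perm_rev.
have closed w z : w \in x :: p -> z \in F -> adj w z -> z \in x :: p.
  move=> wp zF wz; apply/negPn/negP => zNp.
  have [||||t tP sz_t] := spath_of_cycle F c w z cyc _ _ _ zF wz.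
  - by rewrite (perm_uniq perm_c).
  - by rewrite (perm_all _ perm_c); apply/allP.
  - by rewrite (perm_mem perm_c).
  - by rewrite (perm_mem perm_c).
  by have := longest _ tP; rewrite sz_t (perm_size perm_c) ltnn.
(* By [closed] no edge leaves the path, and its [size p + 1] vertices have
   at most [size p <= d] neighbours each within it. *)
exists [set w in x :: p].
have cardS : #|[set w in x :: p]| = (size p).+1.
  by rewrite cardsE (card_uniqP unq).
split; [by apply/subsetP => w; rewrite inE; apply: sub | by rewrite cardS |].
have -> : edges [set w in x :: p] (F :\: [set w in x :: p]) = 0.
  apply: big1 => w wp; apply: big1 => z /setDP[zF zNp].
  rewrite !in_set in wp zNp.
  by case wz: (adj w z) => //; rewrite (closed w z wp zF wz) in zNp.
by rewrite addn0 (leq_trans (edges_self_le _)) // cardS leq_mul2r size_p orbT.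
Qed.

Theorem erdos_gallai F d :
  (forall s, spath F s -> size s <= d.+1) -> edges F F <= d * #|F|.
Proof.
have [m] := ubnP #|F|; elim: m F => // m IHm F /ltnSE-leFm bound.
case: (set_0Vmem F) => [-> | [v vF]]; first by rewrite /edges big_set0.
have [S [sSF S_gt0 sparse]] := sparse_piece F d v vF bound.
have cardF : #|F| = #|S| + #|F :\: S| by rewrite -(cardsID S) (setIidPr sSF).
have IH : edges (F :\: S) (F :\: S) <= d * #|F :\: S|.
  apply: IHm => [|s /and3P[srt unq /allP sub]]; first by lia.
  apply: bound; rewrite /spath srt unq; apply/allP => u /sub.
  by case/setDP.
rewrite (edges_splitl _ _ _ sSF) !(edges_splitr _ _ _ sSF) (edgesC (F :\: S) S).
by rewrite cardF mulnDr; lia.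
Qed.

(** * Path vertex covers *)

Lemma has_subgraph_path k S s :
  spath (~: S) s -> k <= size s -> has_subgraph (del_vertices S) (path_graph k).
Proof.
case: k => [|k] sP le_ks.
  apply/existsP; have f0 : 'I_0 -> del_vertices S by case.
  exists [ffun i => f0 i]; apply/andP; split; first by apply/injectiveP => -[].
  by apply/forallP => -[].
case: s sP le_ks => // x p /and3P[srt unq /allP sub] le_ks.
have xS : x \notin S by have := sub x (mem_head _ _); rewrite /= inE.
(* The path avoids [S] and has at least [k + 1] vertices, so [insubd] returns
   its entries themselves ([valf]). *)
pose f (i : 'I_k.+1) : del_vertices S := insubd (Sub x xS) (nth x (x :: p) i).
have valf i : val (f i) = nth x (x :: p) i.
  rewrite /f insubdK // unfold_in.
  have : nth x (x :: p) i \in x :: p.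
    by apply: mem_nth; apply: leq_trans le_ks.
  by move/sub; rewrite /= inE.
have step (i j : 'I_k.+1) : i.+1 == j -> adj (val (f i)) (val (f j)).
  move=> /eqP ij; rewrite !valf -ij; apply: (pathP x srt).
  by rewrite -ltnS ij; apply: leq_trans le_ks.
apply/existsP; exists [ffun i => f i]; apply/andP; split.
  apply/injectiveP => i j; rewrite !ffunE => /(congr1 val); rewrite !valf.
  move/eqP; rewrite nth_uniq //; try exact: leq_trans (ltn_ord _) le_ks.
  by move/eqP/val_inj.
apply/forallP => i; apply/forallP => j; apply/implyP => ij.
rewrite !ffunE; case/orP: ij => /step //.
by rewrite adj_sym.
Qed.

Lemma kpath_vertex_cover_size d S s :
  kpath_vertex_cover d.+2 S -> spath (~: S) s -> size s <= d.+1.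
Proof.
move=> cov sP; rewrite leqNgt; apply: contra cov.
exact: has_subgraph_path.
Qed.

(** Double count of the edges between [S] and its complement: [low] and [high]
    estimate them from the two sides, and [EG] bounds those that the degrees
    over the complement count inside it. *)
Lemma kpath_vertex_cover_bound d S :
  kpath_vertex_cover d.+2 S -> d <= min_degree G ->
  (min_degree G - d) * #|G| <= (min_degree G - d + max_degree G) * #|S|.
Proof.
move=> cov led.
have EG := erdos_gallai _ _ (fun s => kpath_vertex_cover_size _ _ s cov).
have low := min_degree_le_edges (~: S).
have high := edges_le_max_degree S (~: S).
have cardG := cardsC S.
rewrite (edges_splitr (~: S) _ _ (subsetT _)) setTD setCK (edgesC _ S) in low.
have : (min_degree G - d) * #|~: S| <= max_degree G * #|S|.
  by rewrite mulnBl; lia.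
by rewrite -cardG mulnDr mulnDl; lia.
Qed.

Lemma psi_bound d : d <= min_degree G ->
  (min_degree G - d) * #|G| <= (min_degree G - d + max_degree G) * psi d.+2 G.
Proof.
move=> led; rewrite /psi.
(* The default value of the minimum is [#|G|], for which the bound is trivial. *)
apply: (big_ind (fun m => _ <= _ * m)) => [|m1 m2 h1 h2|S cov].
- by rewrite leq_mul2r leq_addr orbT.
- by rewrite /minn; case: ifP.
- exact: kpath_vertex_cover_bound.
Qed.

End Edges.

Local Open Scope ring_scope.

Theorem theorem15 (G : sgraph) (k : nat)
    (hk : (3 <= k)%N) (hdelta : (k - 1 <= min_degree G)%N) :
  let n : rat := #|G|%:R in
  let delta : rat := (min_degree G)%:R in
  let Delta : rat := (max_degree G)%:R in
  (delta - k%:R + 2) / (delta + Delta - k%:R + 2) * n <= (psi k G)%:R.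
Proof.
cbv zeta; set delta : rat := (min_degree G)%:R.
set Delta : rat := (max_degree G)%:R.
case: k hk hdelta => [|[|d]] // _ hdelta.
have led : (d < min_degree G)%N by lia.
have numE : delta - d.+2%:R + 2 = (min_degree G - d)%:R.
  by rewrite natrB 1?ltnW // -[d.+2]addn2 natrD /delta; ring.
have denE : delta + Delta - d.+2%:R + 2 = (min_degree G - d + max_degree G)%:R.
  by rewrite natrD -numE; ring.
rewrite numE denE mulrAC ler_pdivrMr ?ltr0n; last by lia.
by rewrite mulrC [X in _ <= X]mulrC -!natrM ler_nat mulnC psi_bound // ltnW.
Qed.
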